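(* Let $\exists\vec x\,E(\vec x)$ be a formula of $L(\mathbf{PC}^=)$ with $E(\vec x)$ quantifier-free, and let $\pi$ be a proof of $\exists\vec x\,E(\vec x)$ in $\mathbf{PC}^=$. Then there are $n\le 2_{2\cdot\mathrm{cc}(\pi)}^{3\cdot\mathrm{cc}(\pi)}$ and tuples of $\varepsilon$-free terms $\vec t_0,\dots,\vec t_n$ such that $\mathbf{EC}^=\vdash\bigvee_{i=0}^nE(\vec t_i)$.
   Context: First-order language with function symbols, predicate symbols and equality $=$; terms built from variables and function symbols; formulas built with $\neg,\to,\land,\lor,\forall,\exists$. $L(\mathbf{PC}^=)$ is this ($\varepsilon$-free) language. A proof of $A$ in a Hilbert-style system $\mathbf S$ is a finite list of formulas ending with $A$, each an initial formula or obtained from earlier ones by a rule. $\mathbf{EC}$: initial formulas all propositional tautologies (substitution instances of classical tautologies, quantified formulas treated as atoms), rule modus ponens. $\mathbf{PC}$: initial formulas the propositional tautologies and all instances of $(\forall^-)$ $\forall xA(x)\to A(t)$ and $(\exists^+)$ $A(t)\to\exists xA(x)$; rules modus ponens, $(\forall^+)$: from $A\to B(a)$ infer $A\to\forall xB(x)$, and $(\exists^-)$: from $A(a)\to B$ infer $\exists xA(x)\to B$, with the usual eigenvariable condition that $a$ does not occur in the conclusion. $\mathbf{EQ}$: the formulas $t=t$, $s=t\to t=s$, $s=t\to t=u\to s=u$, $\vec s=\vec t\to P\vec s\to P\vec t$, $\vec s=\vec t\to f\vec s=f\vec t$. $\mathbf{PC}^=:=\mathbf{PC}+\mathbf{EQ}$,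 $\mathbf{EC}^=:=\mathbf{EC}+\mathbf{EQ}$ (the latter over quantifier-free formulas). The critical count $\mathrm{cc}(\pi)$ of a $\mathbf{PC}^=$-proof is the number of instances of $(\forall^-)$ and $(\exists^+)$ in $\pi$. Hyperexponentiation: $2_0^m=m$, $2_{n+1}^m=2^{2_n^m}$.
   Formalization: The proof π is assumed regular: each eigenvariable belongs to exactly one inference and does not occur from that inference's conclusion onward. For list proofs that reuse eigenvariables and share lines, the stated bound in terms of cc(π) fails. *)

(* Defs.v *)
From HB Require Import structures.
From mathcomp Require Import all_boot.

Set Implicit Arguments.
Unset Strict Implicit.
Unset Printing Implicit Defensive.

Record signature := Signature {
  fsym : Type;
  fun_arity : fsym -> nat;
  psym : Type;
  pred_arity : psym -> nat
}.

(* Syntax is in de Bruijn style, so formulas are taken modulo renaming of     *)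
(* bound variables: [Var n] lying under d quantifiers is bound when n < d,    *)
(* and is the free variable number n - d otherwise. Hence every formula is    *)
(* meaningful, with free variables indexed by nat. There is no epsilon.       *)
Inductive term (S : signature) : Type :=
  | Var of nat
  | Fun (f : fsym S) of {ffun 'I_(fun_arity f) -> term S}.

Inductive form (S : signature) : Type :=
  | Pred (p : psym S) of {ffun 'I_(pred_arity p) -> term S}
  | Eq of term S & term S
  | Neg of form S
  | Imp of form S & form S
  | And of form S & form S
  | Or of form S & form S
  | All of form S
  | Ex of form S.

Arguments Var {S} _.
Arguments Fun {S} f _.
Arguments Pred {S} p _.

Fixpoint tsubst (S : signature) (s : nat -> term S) (t : term S) : term S :=
  match t with
  | Var n => s n
  | Fun f ts => Fun f [ffun i => tsubst s (ts i)]
  end.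

Definition up (S : signature) (s : nat -> term S) : nat -> term S :=
  fun n => if n is m.+1 then tsubst (fun i => Var i.+1) (s m) else Var 0.

Fixpoint fsubst (S : signature) (s : nat -> term S) (A : form S) : form S :=
  match A with
  | Pred p ts => Pred p [ffun i => tsubst s (ts i)]
  | Eq t u => Eq (tsubst s t) (tsubst s u)
  | Neg B => Neg (fsubst s B)
  | Imp B C => Imp (fsubst s B) (fsubst s C)
  | And B C => And (fsubst s B) (fsubst s C)
  | Or B C => Or (fsubst s B) (fsubst s C)
  | All B => All (fsubst (up s) B)
  | Ex B => Ex (fsubst (up s) B)
  end.

(* A(t_0, ..., t_(k-1)): the indices 0, ..., k-1, bound in [iter k (@Ex S) A] *)
(* with 0 innermost, are replaced by the t_i; the higher ones drop by k.      *)
Definition inst (S : signature) (ts : seq (term S)) (A : form S) : form S :=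
  fsubst (fun i => nth (Var (i - size ts)) ts i) A.

Fixpoint toccurs (S : signature) (a : nat) (t : term S) : bool :=
  match t with
  | Var n => n == a
  | Fun f ts => [exists i, toccurs a (ts i)]
  end.

Fixpoint foccurs (S : signature) (a : nat) (A : form S) : bool :=
  match A with
  | Pred p ts => [exists i, toccurs a (ts i)]
  | Eq t u => toccurs a t || toccurs a u
  | Neg B => foccurs a B
  | Imp B C | And B C | Or B C => foccurs a B || foccurs a C
  | All B | Ex B => foccurs a.+1 B
  end.

Fixpoint qfree (S : signature) (A : form S) : bool :=
  match A with
  | Pred _ _ | Eq _ _ => true
  | Neg B => qfree B
  | Imp B C | And B C | Or B C => qfree B && qfree C
  | All _ | Ex _ => false
  end.

(* [v] is only consulted at atomic and quantified formulas.                   *)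
Fixpoint eval (S : signature) (v : form S -> bool) (A : form S) : bool :=
  match A with
  | Neg B => ~~ eval v B
  | Imp B C => eval v B ==> eval v C
  | And B C => eval v B && eval v C
  | Or B C => eval v B || eval v C
  | _ => v A
  end.

Definition tautology (S : signature) (A : form S) : Prop :=
  forall v : form S -> bool, eval v A.

(* s_0 = t_0 -> ... -> s_(n-1) = t_(n-1) -> A *)
Definition imp_eqs (S : signature) (n : nat) (s t : {ffun 'I_n -> term S})
    (A : form S) : form S :=
  foldr (fun i B => Imp (Eq (s i) (t i)) B) A (enum 'I_n).

Inductive EQ (S : signature) : form S -> Prop :=
  | EQ_refl t : EQ (Eq t t)
  | EQ_sym s t : EQ (Imp (Eq s t) (Eq t s))
  | EQ_trans s t u : EQ (Imp (Eq s t) (Imp (Eq t u) (Eq s u)))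
  | EQ_pred (p : psym S) (s t : {ffun 'I_(pred_arity p) -> term S}) :
      EQ (imp_eqs s t (Imp (Pred p s) (Pred p t)))
  | EQ_fun (f : fsym S) (s t : {ffun 'I_(fun_arity f) -> term S}) :
      EQ (imp_eqs s t (Eq (Fun f s) (Fun f t))).

(* How a line of a proof is obtained; numbers k, l refer to earlier lines     *)
(* (from 0), and a is the eigenvariable.                                      *)
Inductive reason : Type :=
  | ByTaut
  | ByEQ
  | ByAllElim
  | ByExIntro
  | ByMP of nat & nat
  | ByAllIntro (k a : nat)
  | ByExElim (k a : nat).

Definition line (S : signature) : Type := (form S * reason)%type.

Definition step_ok (S : signature) (G : seq (form S)) (A : form S)
    (r : reason) : Prop :=
  match r with
  | ByTaut => tautology A
  | ByEQ => EQ A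
  | ByAllElim => exists B t, A = Imp (All B) (inst [:: t] B)
  | ByExIntro => exists B t, A = Imp (inst [:: t] B) (Ex B)
  | ByMP k l => exists B, onth G k = Some (Imp B A) /\ onth G l = Some B
  | ByAllIntro k a => exists B C,
      [/\ A = Imp B (All C),
          onth G k = Some (Imp B (inst [:: Var a] C))
        & ~~ foccurs a A]
  | ByExElim k a => exists B C,
      [/\ A = Imp (Ex B) C,
          onth G k = Some (Imp (inst [:: Var a] B) C)
        & ~~ foccurs a A]
  end.

Definition derivation (S : signature) (pi : seq (line S)) (A : form S) : Prop :=
  (forall i B r, onth pi i = Some (B, r) -> step_ok (unzip1 (take i pi)) B r)
  /\ (exists pi' r, pi = rcons pi' (A, r)).

Definition eigenvar (r : reason) : option nat :=
  match r with
  | ByAllIntro _ a | ByExElim _ a => Some a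
  | _ => None
  end.

(* The usual regularity convention: an eigenvariable belongs to exactly one   *)
(* inference and occurs only before the conclusion of that inference. It      *)
(* matters because lines of a list may be shared: if eigenvariables could be  *)
(* reused, one line A(a) could serve in unboundedly many inferences and the   *)
(* number of Herbrand terms would not be bounded by any function of the       *)
(* number of quantifier axioms. Any derivation can be brought into this form  *)
(* by duplicating shared lines and renaming eigenvariables.                   *)
Definition regular (S : signature) (pi : seq (line S)) : Prop :=
  forall i B r a, onth pi i = Some (B, r) -> eigenvar r = Some a ->
    (forall j C q, i <= j -> onth pi j = Some (C, q) -> ~~ foccurs a C)
    /\ (forall j C q, onth pi j = Some (C, q) -> eigenvar q = Some a -> j = i).

Definition PCeq_proof (S : signature) (pi : seq (line S)) (A : form S) : Prop :=
  derivation pi A /\ regular pi.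

Definition critical (r : reason) : bool :=
  match r with ByAllElim | ByExIntro => true | _ => false end.

Definition cc (S : signature) (pi : seq (line S)) : nat :=
  count (fun l => critical l.2) pi.

Definition ec_reason (r : reason) : bool :=
  match r with ByTaut | ByEQ | ByMP _ _ => true | _ => false end.

Definition ECeq_provable (S : signature) (A : form S) : Prop :=
  exists pi : seq (line S),
    derivation pi A /\ all (fun l => qfree l.1 && ec_reason l.2) pi.

(* A_0 \/ ... \/ A_n *)
Fixpoint bigOr (S : signature) (A : nat -> form S) (n : nat) : form S :=
  if n is m.+1 then Or (bigOr A m) (A n) else A 0.

Fixpoint hyperexp (n m : nat) : nat :=
  if n is n'.+1 then 2 ^ hyperexp n' m else m.

(* Main.v *)
(* Treating quantified formulas as propositional atoms, a regular proof shows *)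
(* that its end formula is a tautological consequence of equality axioms, of  *)
(* its critical axioms [All B -> B(t)], [B(t) -> Ex B], and of Henkin axioms  *)
(* [B(a) -> All B], [Ex B -> B(a)], one per eigenvariable [a]; regularity     *)
(* makes this system of Henkin constants acyclic. Further Henkin constants    *)
(* turn [Ex ... Ex E] into [E(c)]. This plays the role of the embedding into  *)
(* the epsilon calculus, and the critical axioms are removed as in Hilbert's  *)
(* first epsilon theorem. Let [F = All B] have maximal quantifier depth among *)
(* the formulas with critical axioms, say [F -> B(t_1)], ..., [F -> B(t_w)].  *)
(* If all [B(t_i)] hold, declare [F] true; if [B(t_i)] fails, declare [F]     *)
(* false and substitute [t_i] for the constants of [F]. So [F] can be removed *)
(* at the price of [w] substituted copies of everything else, in which the    *)
(* constants depending on those of [F] are renamed. If [F] is chosen suitably *)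
(* the other formulas of maximal depth are unchanged in the copies. One such  *)
(* step at most squares the number of critical axioms and disjuncts, so each  *)
(* depth costs two exponentials; and at most [cc pi] depths occur.            *)

From HB Require Import structures.
From mathcomp Require Import all_boot.
From mathcomp Require Import boolp.
Require Import Defs.

Set Implicit Arguments.
Unset Strict Implicit.
Unset Printing Implicit Defensive.

(** Only truth values of atomic and quantified formulas are ever inspected. [proof_axioms] extracts
    from the proof finitely many axioms with the end formula as a propositional consequence;
    [henkin_iter_Ex] adds constants for the leading quantifiers, which yields a [sound] problem with
    a single goal. [eliminate_step] trades one formula of maximal rank for copies of everything
    else, [eliminate_rank] does so for all formulas of that rank, and [eliminate_all] descends
    through the ranks. Without critical axioms the Henkin axioms can be satisfied at will
    ([sound_drop]), so the disjunction of the goals follows from equality axioms alone and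
    [ECeq_provable_taut] derives it.

    For the bound, let [z + 1] count critical axioms and goals. At most [z] formulas share the top
    rank and each step at most squares the count, so one rank leads to at most [(z + 1) ^ (2 ^ z)].
    Initially [z] is [cc pi], which also bounds the number of ranks.

    Equality of terms and formulas is decided classically, since symbols may come from arbitrary
    types. *)

HB.instance Definition _ (S : signature) := gen_eqMixin (term S).
HB.instance Definition _ (S : signature) := gen_eqMixin (form S).

(** * Substitution *)

(** Arguments sit inside a finite function, and the generated induction principle has no hypothesis
    for such nested occurrences. *)
Lemma term_nested_ind (S : signature) (P : term S -> Prop) :
  (forall n, P (Var n)) ->
  (forall f (ts : {ffun 'I_(fun_arity f) -> term S}),
    (forall i, P (ts i)) -> P (Fun f ts)) -> forall t, P t.
Proof.
move=> PV PF; fix IH 1; case=> [n|f ts]; first exact: PV.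
by apply: PF => i; apply: IH.
Qed.

Lemma eq_tsubst_occ (S : signature) (s1 s2 : nat -> term S) t :
  (forall n, toccurs n t -> s1 n = s2 n) -> tsubst s1 t = tsubst s2 t.
Proof.
elim/term_nested_ind: t => [n|f ts IH] /= eq_s; first exact: eq_s.
congr Fun; apply/ffunP=> i; rewrite !ffunE; apply: IH => n occ_n.
by apply: eq_s; apply/existsP; exists i.
Qed.

Lemma eq_fsubst_occ (S : signature) (s1 s2 : nat -> term S) A :
  (forall n, foccurs n A -> s1 n = s2 n) -> fsubst s1 A = fsubst s2 A.
Proof.
have sum (s s' : nat -> term S) B C :
    (forall n, foccurs n B || foccurs n C -> s n = s' n) ->
    (forall n, foccurs n B -> s n = s' n) /\
    (forall n, foccurs n C -> s n = s' n).
  by move=> eq_s; split=> n occ_n; apply: eq_s; rewrite occ_n ?orbT.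
have under (s s' : nat -> term S) B :
    (forall n, foccurs n.+1 B -> s n = s' n) ->
    forall n, foccurs n B -> up s n = up s' n.
  by move=> eq_s [|n] //= /eq_s ->.
elim: A s1 s2 => [p ts|t u|B IH|B IHB C IHC|B IHB C IHC|B IHB C IHC|B IH|B IH]
  s1 s2 /=.
- move=> eq_s; congr Pred; apply/ffunP=> i; rewrite !ffunE.
  apply: eq_tsubst_occ => n occ_n.
  by apply: eq_s; apply/existsP; exists i.
- move=> eq_s; congr Eq; apply: eq_tsubst_occ => n occ_n; apply: eq_s;
  by rewrite occ_n ?orbT.
- by move/IH->.
- by case/sum => /IHB -> /IHC ->.
- by case/sum => /IHB -> /IHC ->.
- by case/sum => /IHB -> /IHC ->.
- by move/under/IH->.
- by move/under/IH->.
Qed.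

Lemma eq_tsubst (S : signature) (s1 s2 : nat -> term S) :
  s1 =1 s2 -> tsubst s1 =1 tsubst s2.
Proof. by move=> eq_s t; apply: eq_tsubst_occ => n _. Qed.

Lemma eq_fsubst (S : signature) (s1 s2 : nat -> term S) :
  s1 =1 s2 -> fsubst s1 =1 fsubst s2.
Proof. by move=> eq_s A; apply: eq_fsubst_occ => n _. Qed.

Lemma tsubst_Var (S : signature) (t : term S) : tsubst Var t = t.
Proof.
elim/term_nested_ind: t => //= f ts IH.
by congr Fun; apply/ffunP=> i; rewrite ffunE.
Qed.

Lemma up_Var (S : signature) : up (@Var S) =1 Var.
Proof. by case. Qed.

Lemma fsubst_Var (S : signature) (A : form S) : fsubst Var A = A.
Proof.
elim: A => [p ts|t u|B IH|B IHB C IHC|B IHB C IHC|B IHB C IHC|B IH|B IH] /=.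
- by congr Pred; apply/ffunP=> i; rewrite ffunE tsubst_Var.
- by rewrite !tsubst_Var.
- by rewrite IH.
- by rewrite IHB IHC.
- by rewrite IHB IHC.
- by rewrite IHB IHC.
- by rewrite (eq_fsubst (@up_Var S)) IH.
- by rewrite (eq_fsubst (@up_Var S)) IH.
Qed.

Lemma fsubst_id_occ (S : signature) (s : nat -> term S) A :
  (forall n, foccurs n A -> s n = Var n) -> fsubst s A = A.
Proof. by move/eq_fsubst_occ->; apply: fsubst_Var. Qed.

Lemma tsubst_comp (S : signature) (s1 s2 : nat -> term S) t :
  tsubst s1 (tsubst s2 t) = tsubst (fun n => tsubst s1 (s2 n)) t.
Proof.
elim/term_nested_ind: t => //= f ts IH.
by congr Fun; apply/ffunP=> i; rewrite !ffunE.
Qed.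

Lemma up_comp (S : signature) (s1 s2 : nat -> term S) :
  (fun n => tsubst (up s1) (up s2 n)) =1 up (fun n => tsubst s1 (s2 n)).
Proof. by case=> //= n; rewrite !tsubst_comp. Qed.

Lemma fsubst_comp (S : signature) (s1 s2 : nat -> term S) A :
  fsubst s1 (fsubst s2 A) = fsubst (fun n => tsubst s1 (s2 n)) A.
Proof.
elim: A s1 s2 => [p ts|t u|B IH|B IHB C IHC|B IHB C IHC|B IHB C IHC|B IH|B IH]
  s1 s2 /=.
- by congr Pred; apply/ffunP=> i; rewrite !ffunE tsubst_comp.
- by rewrite !tsubst_comp.
- by rewrite IH.
- by rewrite IHB IHC.
- by rewrite IHB IHC.
- by rewrite IHB IHC.
- by rewrite IH (eq_fsubst (up_comp _ _)).
- by rewrite IH (eq_fsubst (up_comp _ _)).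
Qed.

Lemma fsubst_inst1 (S : signature) (s : nat -> term S) t B :
  fsubst s (inst [:: t] B) = inst [:: tsubst s t] (fsubst (up s) B).
Proof.
rewrite /inst !fsubst_comp; apply: eq_fsubst => -[|n] //=.
rewrite nth_nil subn1 /= tsubst_comp -[LHS]tsubst_Var.
by apply: eq_tsubst => m /=; rewrite nth_nil subn1.
Qed.

Lemma foccurs_iter_Ex (S : signature) k a (E : form S) :
  foccurs a (iter k (@Ex S) E) = foccurs (k + a) E.
Proof. by elim: k a => //= k IH a; rewrite IH addSnnS. Qed.

(** The indices of [E] from [size ts] on are the free variables of the quantified formula. As [s]
    fixes them, it acts on the inserted terms only. *)
Lemma fsubst_inst (S : signature) (s : nat -> term S) ts E :
  (forall a, foccurs a (iter (size ts) (@Ex S) E) -> s a = Var a) ->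
  fsubst s (inst ts E) = inst (map (tsubst s) ts) E.
Proof.
move=> fix_s; rewrite /inst fsubst_comp; apply: eq_fsubst_occ => n occ_n.
rewrite size_map; case: (ltnP n (size ts)) => [lt_n|le_n].
  by rewrite (nth_map (Var (n - size ts))).
rewrite !nth_default ?size_map //=; apply: fix_s.
by rewrite foccurs_iter_Ex subnKC.
Qed.

Lemma inst_cons (S : signature) c (ts : seq (term S)) E :
  inst [:: c] (fsubst (up (fun i => nth (Var (i - size ts)) ts i)) E) =
  inst (c :: ts) E.
Proof.
rewrite /inst fsubst_comp; apply: eq_fsubst => -[|n] //=.
rewrite tsubst_comp subSS -[RHS]tsubst_Var; apply: eq_tsubst => m /=.
by rewrite nth_nil subn1.
Qed.

Lemma toccurs_tsubst (S : signature) (s : nat -> term S) n t :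
  toccurs n (tsubst s t) -> exists2 m, toccurs m t & toccurs n (s m).
Proof.
elim/term_nested_ind: t => [m|f ts IH] /=; first by exists m.
case/existsP=> i; rewrite ffunE => /IH[m occ_m occ_n].
by exists m => //; apply/existsP; exists i.
Qed.

Lemma foccurs_fsubst (S : signature) (s : nat -> term S) n A :
  foccurs n (fsubst s A) -> exists2 m, foccurs m A & toccurs n (s m).
Proof.
have under (r : nat -> term S) B p :
    (exists2 m, foccurs m B & toccurs p.+1 (up r m)) ->
    exists2 m, foccurs m.+1 B & toccurs p (r m).
  case=> -[|m] //= occ_m /toccurs_tsubst[q occ_q /eqP[eq_qp]].
  by exists m => //; rewrite -eq_qp.
elim: A s n => [p ts|t u|B IH|B IHB C IHC|B IHB C IHC|B IHB C IHC|B IH|B IH]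
  s n /=.
- case/existsP=> i; rewrite ffunE => /toccurs_tsubst[m occ_m occ_n].
  by exists m => //; apply/existsP; exists i.
- by case/orP=> /toccurs_tsubst[m occ_m occ_n]; exists m; rewrite ?occ_m ?orbT.
- exact: IH.
- by case/orP=> [/IHB|/IHC] [m occ_m occ_n]; exists m; rewrite ?occ_m ?orbT.
- by case/orP=> [/IHB|/IHC] [m occ_m occ_n]; exists m; rewrite ?occ_m ?orbT.
- by case/orP=> [/IHB|/IHC] [m occ_m occ_n]; exists m; rewrite ?occ_m ?orbT.
- by move/IH/under.
- by move/IH/under.
Qed.

Lemma term_bound (S : signature) (t : term S) :
  exists N, forall n, N <= n -> ~~ toccurs n t.
Proof.
elim/term_nested_ind: t => [m|f ts /fin_all_exists[N N_ub]].
  by exists m.+1 => n; rewrite /= neq_ltn => ->.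
exists (\max_i N i) => n le_n; apply/existsPn=> i; apply: N_ub.
by apply: leq_trans le_n; apply: leq_bigmax.
Qed.

Lemma form_bound (S : signature) (A : form S) :
  exists N, forall n, N <= n -> ~~ foccurs n A.
Proof.
have max (P Q : nat -> bool) : (exists N, forall n, N <= n -> ~~ P n) ->
    (exists N, forall n, N <= n -> ~~ Q n) ->
    exists N, forall n, N <= n -> ~~ (P n || Q n).
  move=> [N1 ub1] [N2 ub2]; exists (maxn N1 N2) => n.
  by rewrite geq_max negb_or => /andP[/ub1-> /ub2->].
elim: A => [p ts|t u|B IH|B IHB C IHC|B IHB C IHC|B IHB C IHC|B IH|B IH] /=.
- have /fin_all_exists[N N_ub] := fun i => term_bound (ts i).
  exists (\max_i N i) => n le_n; apply/existsPn=> i; apply: N_ub.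
  by apply: leq_trans le_n; apply: leq_bigmax.
- exact: max (term_bound _) (term_bound _).
- exact: IH.
- exact: max.
- exact: max.
- exact: max.
- by case: IH => N ub; exists N => n le_n; apply/ub/leqW.
- by case: IH => N ub; exists N => n le_n; apply/ub/leqW.
Qed.

(** * Evaluation *)

Fixpoint qdepth (S : signature) (A : form S) : nat :=
  match A with
  | Pred _ _ | Eq _ _ => 0
  | Neg B => qdepth B
  | Imp B C | And B C | Or B C => maxn (qdepth B) (qdepth C)
  | All B | Ex B => (qdepth B).+1
  end.

Lemma qdepth_fsubst (S : signature) (s : nat -> term S) A :
  qdepth (fsubst s A) = qdepth A.
Proof.
elim: A s => //= [B IHB C IHC|B IHB C IHC|B IHB C IHC|B IH|B IH] s;
by rewrite ?IHB ?IHC ?IH.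
Qed.

Lemma qdepth_qfree (S : signature) (A : form S) : qfree A -> qdepth A = 0.
Proof.
by elim: A => //= B IHB C IHC /andP[/IHB-> /IHC->].
Qed.

Lemma qfree_fsubst (S : signature) (s : nat -> term S) A :
  qfree (fsubst s A) = qfree A.
Proof. by elim: A s => //= B IHB C IHC s; rewrite IHB IHC. Qed.

(** Evaluation consults the valuation only at components of [A], none deeper than [A]. So the value
    of a quantified formula can be redefined without affecting shallower formulas, in particular
    instances of its own body. *)
Lemma eval_agree (S : signature) r (v1 v2 : form S -> bool) A :
  (forall X, qdepth X < r -> v1 X = v2 X) -> qdepth A < r ->
  eval v1 A = eval v2 A.
Proof.
move=> eq_v.
elim: A => [p ts|t u|B IH|B IHB C IHC|B IHB C IHC|B IHB C IHC|B IH|B IH] /=;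
  rewrite ?gtn_max.
- by move=> lt_r; apply: eq_v.
- by move=> lt_r; apply: eq_v.
- by move/IH->.
- by case/andP=> /IHB-> /IHC->.
- by case/andP=> /IHB-> /IHC->.
- by case/andP=> /IHB-> /IHC->.
- by move=> lt_r; apply: eq_v.
- by move=> lt_r; apply: eq_v.
Qed.

Lemma eval_fsubst (S : signature) (v : form S -> bool) s A :
  eval v (fsubst s A) = eval (fun X => v (fsubst s X)) A.
Proof. by elim: A => //= [B ->|B -> C ->|B -> C ->|B -> C ->]. Qed.

Lemma EQ_fsubst (S : signature) (s : nat -> term S) A :
  EQ A -> EQ (fsubst s A).
Proof.
have subst_imp n (t u : {ffun 'I_n -> term S}) B :
    fsubst s (imp_eqs t u B) =
    imp_eqs [ffun i => tsubst s (t i)] [ffun i => tsubst s (u i)] (fsubst s B).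
  rewrite /imp_eqs; elim: (enum 'I_n) => //= i l ->.
  by rewrite !ffunE.
case=> [t|t u|t u w|p t u|f t u]; rewrite ?subst_imp.
- exact: EQ_refl.
- exact: EQ_sym.
- exact: EQ_trans.
- exact: EQ_pred.
- exact: EQ_fun.
Qed.

Lemma EQ_qfree (S : signature) (A : form S) : EQ A -> qfree A.
Proof.
have qfree_imp n (t u : {ffun 'I_n -> term S}) B :
    qfree B -> qfree (imp_eqs t u B).
  by rewrite /imp_eqs => qfB; elim: (enum 'I_n).
by case=> *; rewrite ?qfree_imp.
Qed.

(** * Henkin problems *)

(** The flag is [true] for a universal formula. It is also the truth value of the formula that makes
    all its Henkin axioms hold; the opposite value makes all its critical axioms hold. *)
Definition quant (S : signature) : Type := (bool * form S)%type.

Definition qform (S : signature) (F : quant S) : form S :=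
  if F.1 then All F.2 else Ex F.2.

Definition qsubst (S : signature) (s : nat -> term S) (F : quant S) : quant S :=
  (F.1, fsubst (up s) F.2).

(* Both polarities at once: for [F = (true, B)] these are the truth values of *)
(* [All B -> B(t)] and [B(a) -> All B], for [F = (false, B)] those of         *)
(* [B(t) -> Ex B] and [Ex B -> B(a)].                                         *)
Definition crit_true (S : signature) (v : form S -> bool)
    (c : quant S * term S) : bool :=
  (v (qform c.1) == c.1.1) ==> (eval v (inst [:: c.2] c.1.2) == c.1.1).

Definition henkin_true (S : signature) (v : form S -> bool)
    (h : quant S * nat) : bool :=
  (eval v (inst [:: Var h.2] h.1.2) == h.1.1) ==> (v (qform h.1) == h.1.1).

Definition henkin_before (S : signature) (h h' : quant S * nat) : bool :=
  ~~ foccurs h.2 (qform h'.1) && (h.2 != h'.2).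

(** Dependencies point to the right: among the constants of the list, a formula may contain only
    those of later entries. *)
Definition henkin_ordered (S : signature) (hs : seq (quant S * nat)) : bool :=
  all (fun h => ~~ foccurs h.2 (qform h.1)) hs &&
  pairwise (@henkin_before S) hs.

Record problem (S : signature) (k : nat) : Type := Problem {
  eqs : seq (form S);
  crits : seq (quant S * term S);
  henkins : seq (quant S * nat);
  goals : seq (k.-tuple (term S))
}.

(** The constants must avoid the end formula so that replacing them turns instances of [E] into
    instances of [E]. *)
Definition sound (S : signature) (k : nat) (E : form S)
    (P : problem S k) : Prop :=
  [/\ {in eqs P, forall A, EQ A},
      henkin_ordered (henkins P),
      {in henkins P, forall h, ~~ foccurs h.2 (iter k (@Ex S) E)},
      0 < size (goals P)
    & forall v, all (eval v) (eqs P) -> all (crit_true v) (crits P) ->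
        all (henkin_true v) (henkins P) ->
        has (fun ts : k.-tuple _ => eval v (inst ts E)) (goals P)].

Definition qrank (S : signature) (F : quant S) : nat := qdepth (qform F).

Lemma qrankE (S : signature) (F : quant S) : qrank F = (qdepth F.2).+1.
Proof. by case: F => -[]. Qed.

Lemma qform_inj (S : signature) : injective (@qform S).
Proof. by move=> [[] B] [[] C] //= [->]. Qed.

Lemma fsubst_qform (S : signature) (s : nat -> term S) F :
  fsubst s (qform F) = qform (qsubst s F).
Proof. by case: F => -[]. Qed.

Lemma qrank_qsubst (S : signature) (s : nat -> term S) F :
  qrank (qsubst s F) = qrank F.
Proof. by rewrite !qrankE qdepth_fsubst. Qed.

Lemma qsubst_id (S : signature) (s : nat -> term S) F :
  (forall a, foccurs a (qform F) -> s a = Var a) -> qsubst s F = F.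
Proof. by move/fsubst_id_occ; rewrite fsubst_qform => /qform_inj. Qed.

Lemma qdepth_inst1 (S : signature) t (F : quant S) :
  qdepth (inst [:: t] F.2) < qrank F.
Proof. by rewrite qrankE qdepth_fsubst. Qed.

Lemma henkin_ordered_filter (S : signature) (p : pred (quant S * nat)) hs :
  henkin_ordered hs -> henkin_ordered (filter p hs).
Proof.
case/andP=> /allP irr pw; apply/andP; split.
  by apply/allP=> h; rewrite mem_filter => /andP[_ /irr].
exact: subseq_pairwise (filter_subseq _ _) pw.
Qed.

Lemma henkin_ordered_inj (S : signature) (hs : seq (quant S * nat)) h h' :
  henkin_ordered hs -> h \in hs -> h' \in hs -> h.2 = h'.2 -> h = h'.
Proof.
case/andP=> _; elim: hs => //= h0 hs IH /andP[/allP pw pws].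
rewrite !inE => /predU1P[->|hs_h] /predU1P[->|hs_h'] // eq_a.
- by have := pw _ hs_h'; rewrite /henkin_before eq_a eqxx andbF.
- by have := pw _ hs_h; rewrite /henkin_before -eq_a eqxx andbF.
- exact: IH.
Qed.

(* A quantified formula of depth at least [r] without critical axiom may be   *)
(* declared true (if universal) or false, which validates its Henkin axioms.  *)
Lemma sound_drop (S : signature) (k : nat) (E : form S) (P : problem S k) r :
  qfree E -> sound E P -> 0 < r -> {in crits P, forall c, qrank c.1 <= r} ->
  sound E (Problem (eqs P) (crits P)
    [seq h <- henkins P | (qrank h.1 < r) || (h.1 \in map fst (crits P))]
    (goals P)).
Proof.
move=> qfE [eqP ordP fvP gP valP] r_gt0 le_r; split=> //=.
- exact: henkin_ordered_filter.
- by move=> h; rewrite mem_filter => /andP[_ /fvP].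
move=> v eqv critv henv.
pose v' X := if (qdepth X < r) || (X \in map (@qform S) (map fst (crits P)))
             then v X else if X is All _ then true else false.
have v'E F : v' (qform F) =
    if (qrank F < r) || (F \in map fst (crits P)) then v (qform F) else F.1.
  rewrite /v' (mem_map (@qform_inj S)) -/(qrank F).
  by case: ifP => // _; case: (F) => -[].
have agree A : qdepth A < r -> eval v' A = eval v A.
  by apply: eval_agree => X lt_X; rewrite /v' lt_X.
have qf0 A : qfree A -> eval v' A = eval v A.
  by move=> qfA; apply: agree; rewrite qdepth_qfree.
have := valP v'; rewrite (eq_in_all (a2 := eval v)); last first.
  by move=> A /eqP/EQ_qfree/qf0.
move=> /(_ eqv) has'.
rewrite (eq_has (a2 := fun ts : k.-tuple _ => eval v' (inst ts E))).
  apply: has'.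
    apply/allP=> c cP; rewrite /crit_true v'E map_f ?orbT // agree.
      exact: (allP critv).
    exact: leq_trans (qdepth_inst1 _ _) (le_r _ cP).
  apply/allP=> h hP; rewrite /henkin_true v'E; case: ifP => [keep|_]; last first.
    by rewrite eqxx implybT.
  rewrite agree; first by apply: (allP henv); rewrite mem_filter keep.
  apply: leq_trans (qdepth_inst1 _ _) _; case/orP: keep => [/ltnW//|].
  by case/mapP=> c /le_r le_c ->.
by move=> ts /=; rewrite qf0 // qfree_fsubst.
Qed.

(* Greedy: drop Henkin axioms from the left until some formula of [T] has     *)
(* lost its last one.                                                         *)
Lemma henkin_split (S : signature) (T : seq (quant S)) hs :
  0 < size T -> henkin_ordered hs ->
  exists F h1 h2, [/\ hs = h1 ++ h2, F \in T, F \notin map fst h2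
    & {in T & h1, forall G h, ~~ foccurs h.2 (qform G)}].
Proof.
move=> T_gt0; elim: hs => [|h hs IH] /=.
  by case: T T_gt0 => // F T _ _; exists F, [::], [::]; rewrite mem_head.
case/andP=> /=/andP[irr irrs] /andP[/allP pw pws].
have [/allP allT|] := boolP (all (mem (map fst (h :: hs))) T); last first.
  by case/allPn=> F TF nF; exists F, [::], (h :: hs).
have [|F [h1 [h2 [-> TF nF free]]]] := IH; first by rewrite /henkin_ordered irrs.
exists F, (h :: h1), h2; split=> // G h' TG.
rewrite inE => /predU1P[->|]; last exact: free.
(* [G] still has a Henkin axiom [h0], which is [h] or stands to its right; either way the constant
   of [h] does not occur in [G]. *)
have /mapP[h0 + ->] := allT _ TG; rewrite inE => /predU1P[->//|/pw].
by case/andP.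
Qed.

(** * Copies with fresh constants *)

Lemma henkins_bound (S : signature) (hs : seq (quant S * nat)) :
  exists N, forall n, N <= n ->
    {in hs, forall h, ~~ foccurs n (qform h.1) && (h.2 < n)}.
Proof.
elim: hs => [|h hs [N ub]]; first by exists 0.
have [M ubM] := form_bound (qform h.1).
exists (maxn N (maxn M h.2.+1)) => n; rewrite !geq_max => /and3P[leN leM lt_h].
by move=> h'; rewrite inE => /predU1P[->|/ub->//]; rewrite ubM.
Qed.

(** The substitution used when the instance of [F] at [t] fails: constants whose formulas may depend
    on those of [F] get new names, with the copied axioms in [H]. *)
Definition renames (S : signature) (F : quant S) (h1 H : seq (quant S * nat))
    (t : term S) (s : nat -> term S) : Prop :=
  [/\ forall a, (F, a) \in h1 -> s a = t,
      {in h1, forall h, h.1 != F ->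
         exists2 a, s h.2 = Var a & (qsubst s h.1, a) \in H}
    & forall a, a \notin map snd h1 -> s a = Var a].

(* The copies refer to the original Henkin constants through [t], so they are *)
(* put in front.                                                              *)
Lemma fresh_copies (S : signature) (F : quant S) h1 h2 (Phi : form S)
    (ts : seq (term S)) :
  henkin_ordered (h1 ++ h2) ->
  {in h1 ++ h2, forall h, ~~ foccurs h.2 Phi} ->
  exists H (sigma : term S -> nat -> term S),
    [/\ henkin_ordered (H ++ [seq h <- h1 | h.1 != F] ++ h2),
        {in H, forall h, ~~ foccurs h.2 Phi}
      & {in ts, forall t, renames F h1 H t (sigma t)}].
Proof.
set h1' := filter _ h1 => ord fv.
have sub1 : {subset h1' <= h1} by move=> h; rewrite mem_filter => /andP[].
elim: ts => [|t ts [H [sigma [ordH fvH renH]]]].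
  exists [::], (fun=> Var); split=> //=.
  case/andP: ord => /allP irr pw.
  apply/andP; split.
    apply/allP=> h; rewrite mem_cat => /orP[/sub1|] hh; apply: irr;
    by rewrite mem_cat hh ?orbT.
  apply: subseq_pairwise pw; apply: cat_subseq => //.
  exact: filter_subseq.
have [N ubN] := henkins_bound (H ++ h1' ++ h2 ++ h1).
have [M ubM] := term_bound t.
have [L ubL] := form_bound Phi.
pose K := maxn N (maxn M L).
have ubK n : K <= n -> [/\ {in H ++ h1' ++ h2 ++ h1, forall h,
    ~~ foccurs n (qform h.1) && (h.2 < n)}, ~~ toccurs n t & ~~ foccurs n Phi].
  by rewrite !geq_max => /and3P[/ubN ? /ubM ? /ubL].
(* [K] lies above the indices in the Henkin lists, in [t] and in [Phi]. A uniform shift is injective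
   and keeps the order of the copies. *)
pose s a := if (F, a) \in h1 then t else
            if a \in map snd h1 then Var (K + a) else Var a.
pose new := [seq (qsubst s h.1, K + h.2) | h <- h1'].
have ord1 : henkin_ordered h1.
  case/andP: ord; rewrite all_cat pairwise_cat => /andP[irr _] /and3P[_ pw _].
  exact/andP.
(* A shifted constant can only come from its original, as [t] and the old formulas have no index
   from [K] on. *)
have new_notin h h' : h' \in h1 -> ~~ foccurs h.2 (qform h'.1) ->
    ~~ foccurs (K + h.2) (qform (qsubst s h'.1)).
  move=> hh' nocc; rewrite -fsubst_qform; apply/negP=> /foccurs_fsubst[m occ_m].
  have [ubs /negP nt _] := ubK (K + h.2) (leq_addr _ _).
  rewrite /s; case: ifP => // _; case: ifP => _ /= /eqP eq_m.
    by move/eqP: eq_m; rewrite eqn_add2l => /eqP eq_m; rewrite -eq_m occ_m in nocc.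
  have /ubs : h' \in H ++ h1' ++ h2 ++ h1 by rewrite !mem_cat hh' !orbT.
  by rewrite -eq_m occ_m.
exists (new ++ H), (fun u => if u == t then s else sigma u); split.
- case/andP: ordH => irrH pwH; case/andP: ord1 => /allP irr1 pw1.
  apply/andP; split.
    rewrite -catA all_cat irrH andbT all_map; apply/allP=> h /sub1 hh /=.
    by apply: new_notin (irr1 _ hh).
  rewrite -catA pairwise_cat pwH andbT; apply/andP; split.
    apply/allrelP=> _ h' /mapP[h /sub1 hh ->] Hh'.
    have [ubs _ _] := ubK (K + h.2) (leq_addr _ _).
    have /ubs/andP[nocc lt_h'] : h' \in H ++ h1' ++ h2 ++ h1.
      by move: Hh'; rewrite !mem_cat => /or3P[]->; rewrite ?orbT.
    by rewrite /henkin_before /= nocc neq_ltn lt_h' orbT.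
  rewrite /new pairwise_map.
  have: pairwise (@henkin_before S) h1'.
    exact: subseq_pairwise (filter_subseq _ _) pw1.
  apply: (sub_in_pairwise (P := mem h1)); last by apply/allP=> h /sub1.
  move=> h h' hh hh' /andP[nocc neq]; rewrite /henkin_before /= eqn_add2l neq.
  by rewrite new_notin.
- move=> h; rewrite mem_cat => /orP[/mapP[h' _ ->]|/fvH//] /=.
  by case: (ubK (K + h'.2) (leq_addr _ _)).
move=> u; rewrite inE.
case: eqVneq => [-> _|_ /= /renH[ren1 ren2 ren3]]; last first.
  split=> // h hh nF; case: (ren2 h hh nF) => a sa Ha; exists a => //.
  by rewrite mem_cat Ha orbT.
split=> [a ha|h hh nF|a na].
- by rewrite /s ha.
- exists (K + h.2).
    (* A constant has only one Henkin axiom, so that of [h] is not sent to [t]. *)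
    rewrite /s map_f // ifF //; apply: contraNF nF => hF.
    by have -> := henkin_ordered_inj ord1 hh hF (erefl _).
  rewrite mem_cat; apply/orP; left.
  by apply/mapP; exists h; rewrite ?mem_filter ?nF.
rewrite /s (negPf na) ifF //; apply: contraNF na => ha.
by apply/mapP; exists (F, a).
Qed.

(** * Elimination of critical axioms *)

Definition csubst (S : signature) (s : nat -> term S)
    (c : quant S * term S) : quant S * term S :=
  (qsubst s c.1, tsubst s c.2).

Definition crit_terms (S : signature) (k : nat) (P : problem S k)
    (F : quant S) : seq (term S) :=
  [seq c.2 | c <- crits P & c.1 == F].

(** The originals serve the case that all critical instances of [F] have value [F.1], the copy for
    [t] the case that the instance at [t] does not. *)
Definition eliminate (S : signature) (k : nat) (P : problem S k) (F : quant S)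
    (sigma : term S -> nat -> term S) (hs : seq (quant S * nat)) :
    problem S k :=
  let ts := crit_terms P F in
  let cs := [seq c <- crits P | c.1 != F] in
  Problem (eqs P ++ [seq fsubst (sigma t) A | t <- ts, A <- eqs P])
    (cs ++ [seq csubst (sigma t) c | t <- ts, c <- cs])
    hs
    (goals P ++ [seq map_tuple (tsubst (sigma t)) g | t <- ts, g <- goals P]).

(** With [w] critical axioms of [F], [c0] others and [g] goals, the new size is
    [(1 + w) * (c0 + g)]. Both factors are at most [w + c0 + g], the first because there is a
    goal. *)
Lemma size_eliminate (S : signature) (k : nat) (P : problem S k) F sigma hs :
  0 < size (goals P) ->
  size (crits (eliminate P F sigma hs)) + size (goals (eliminate P F sigma hs))
    <= (size (crits P) + size (goals P)) ^ 2.
Proof.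
move=> g_gt0; rewrite /= !size_cat !size_allpairs.
set w := size (crit_terms P F); set c0 := size [seq c <- _ | _].
have eq_c : size (crits P) = w + c0.
  by rewrite /w /c0 size_map !size_filter -(count_predC (fun c => c.1 == F)).
rewrite eq_c -!mulSn -mulnDr expnS expn1.
apply: leq_mul; last by rewrite -addnA leq_addl.
by rewrite -addnA -addn1 leq_add2l (leq_trans g_gt0) ?leq_addl.
Qed.

(** Give [F] the value [F.1]: its critical axioms hold by assumption, its Henkin axioms trivially.
    The other axioms keep their values, the instances of bodies being too shallow to contain [F]. *)
Lemma eval_eliminate_true (S : signature) (k : nat) (E : form S)
    (P : problem S k) F v :
  qfree E -> {in eqs P, forall A, qfree A} ->
  {in crits P, forall c, qrank c.1 <= qrank F} ->
  {in henkins P, forall h, qrank h.1 <= qrank F} ->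
  all (eval v) (eqs P) ->
  {in crits P, forall c, c.1 != F -> crit_true v c} ->
  {in henkins P, forall h, h.1 != F -> henkin_true v h} ->
  {in crit_terms P F, forall t, eval v (inst [:: t] F.2) == F.1} ->
  exists v', [/\ all (eval v') (eqs P), all (crit_true v') (crits P),
    all (henkin_true v') (henkins P)
    & forall ts, eval v' (inst ts E) = eval v (inst ts E)].
Proof.
move=> qfE qfeq le_c le_h eqv cv hv Fv.
pose v' X := if X == qform F then F.1 else v X.
have v'E G : v' (qform G) = if G == F then F.1 else v (qform G).
  by rewrite /v' (inj_eq (@qform_inj S)).
have agree A : qdepth A < qrank F -> eval v' A = eval v A.
  apply: eval_agree => X lt_X; rewrite /v'; case: eqP => // eq_X.
  by rewrite eq_X ltnn in lt_X.
have qf0 A : qfree A -> eval v' A = eval v A.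
  by move=> qfA; apply: agree; rewrite qdepth_qfree // qrankE.
exists v'; split.
- by rewrite (eq_in_all (a2 := eval v)) // => A /qfeq/qf0.
- apply/allP=> c cP; rewrite /crit_true v'E agree; last first.
    exact: leq_trans (qdepth_inst1 _ _) (le_c _ cP).
  case: ifP => [/eqP cF|/negbT]; last exact: cv.
  rewrite cF Fv ?implybT //.
  by apply/mapP; exists c; rewrite ?mem_filter ?cF ?eqxx.
- apply/allP=> h hP; rewrite /henkin_true v'E agree; last first.
    exact: leq_trans (qdepth_inst1 _ _) (le_h _ hP).
  by case: ifP => [/eqP->|/negbT]; [rewrite eqxx implybT | exact: hv].
- by move=> ts; rewrite qf0 ?qfree_fsubst.
Qed.

(** Give [F] the value opposite to [F.1] and pull [v] back along [s] elsewhere. The critical axioms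
    of [F] hold vacuously; its Henkin axioms hold because [s] leaves [F] alone and sends its
    constants to [t], which turns their premises into the failing instance. Other Henkin axioms in
    [h1] become their copies in [H]; those in [h2] do not change. *)
Lemma eval_eliminate_false (S : signature) (k : nat) (E : form S)
    (P : problem S k) F h1 h2 H v t s :
  qfree E -> {in eqs P, forall A, qfree A} ->
  {in crits P, forall c, qrank c.1 <= qrank F} ->
  {in henkins P, forall h, qrank h.1 <= qrank F} ->
  henkins P = h1 ++ h2 -> henkin_ordered (h1 ++ h2) -> F \notin map fst h2 ->
  {in h1, forall h, ~~ foccurs h.2 (qform F)} ->
  renames F h1 H t s ->
  {in eqs P, forall A, eval v (fsubst s A)} ->
  {in crits P, forall c, c.1 != F -> crit_true v (csubst s c)} ->
  all (henkin_true v) (H ++ h2) ->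
  eval v (inst [:: t] F.2) != F.1 ->
  exists v', [/\ all (eval v') (eqs P), all (crit_true v') (crits P),
    all (henkin_true v') (henkins P)
    & forall ts, eval v' (inst ts E) = eval v (fsubst s (inst ts E))].
Proof.
move=> qfE qfeq le_c le_h hE ord nF h1F [ren1 ren2 ren3] eqv cv hv Fv.
pose v' X := if X == qform F then ~~ F.1 else v (fsubst s X).
have v'E G : v' (qform G) = if G == F then ~~ F.1 else v (qform (qsubst s G)).
  by rewrite /v' (inj_eq (@qform_inj S)) fsubst_qform.
have agree A : qdepth A < qrank F -> eval v' A = eval v (fsubst s A).
  rewrite eval_fsubst; apply: eval_agree => X lt_X; rewrite /v'.
  by case: eqP => // eq_X; rewrite eq_X ltnn in lt_X.
have qf0 A : qfree A -> eval v' A = eval v (fsubst s A).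
  by move=> qfA; apply: agree; rewrite qdepth_qfree // qrankE.
have fix_s G : {in h1, forall h, ~~ foccurs h.2 (qform G)} -> qsubst s G = G.
  move=> nocc; apply: qsubst_id => a occ_a; apply: ren3.
  by apply: contraL occ_a => /mapP[h /nocc ? ->].
exists v'; split.
- by apply/allP=> A AP; rewrite /= qf0 ?eqv ?qfeq.
- apply/allP=> c cP; rewrite /crit_true v'E agree; last first.
    exact: leq_trans (qdepth_inst1 _ _) (le_c _ cP).
  case: ifP => [/eqP->|/negbT/(cv _ cP)]; first by case: (F.1).
  by rewrite fsubst_inst1.
- apply/allP=> h hP; rewrite /henkin_true v'E agree; last first.
    exact: leq_trans (qdepth_inst1 _ _) (le_h _ hP).
  rewrite fsubst_inst1 -[fsubst (up s) _]/(qsubst s h.1).2.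
  rewrite -[tsubst s (Var h.2)]/(s h.2).
  have := hP; rewrite hE mem_cat => /orP[hh1|hh2].
    case: ifP => [/eqP hF|/negbT hF].
      have -> : s h.2 = t by apply: ren1; rewrite -hF -surjective_pairing.
      by rewrite hF fix_s // (negPf Fv).
    have [a -> Ha] := ren2 _ hh1 hF.
    by have := allP hv (qsubst s h.1, a); rewrite mem_cat Ha => /(_ isT).
  case: ifP => [/eqP hF|_]; first by rewrite -hF map_f in nF.
  case/andP: ord => _; rewrite pairwise_cat => /and3P[/allrelP before _ _].
  rewrite fix_s => [|h' hh']; last by case/andP: (before _ _ hh' hh2).
  rewrite ren3; last first.
    apply/mapP=> -[h' hh' eq_a].
    by have := before _ _ hh' hh2; rewrite /henkin_before eq_a eqxx andbF.
  by have := allP hv h; rewrite mem_cat hh2 orbT => /(_ isT).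
- by move=> ts; rewrite qf0 ?qfree_fsubst.
Qed.

(** By the choice of [F], no formula of rank [r] with a critical axiom contains a constant moved by
    the substitutions. So the copies bring in no new formula of that rank, and [F] itself
    disappears. *)
Lemma eliminate_step (S : signature) (k : nat) (E : form S) (P : problem S k) r :
  qfree E -> sound E P -> {in crits P, forall c, qrank c.1 <= r} ->
  has (fun c => qrank c.1 == r) (crits P) ->
  exists P' : problem S k, exists2 F, F \in map fst (crits P) /\ qrank F = r &
    [/\ sound E P',
        size (crits P') + size (goals P') <= (size (crits P) + size (goals P)) ^ 2
      & {in crits P', forall c', exists2 c, c \in crits P &
          [/\ c.1 != F, qrank c'.1 = qrank c.1
            & qrank c.1 = r -> c'.1 = c.1]}].
Proof.
move=> qfE sndP le_r /hasP[c0 c0P /eqP c0r].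
have r_gt0 : 0 < r by rewrite -c0r qrankE.
(* Afterwards no Henkin formula has rank above [r], so instances of their bodies are too shallow to
   contain [F]. *)
have := sound_drop qfE sndP r_gt0 le_r.
set Q := Problem _ _ _ _ => sndQ; have [eqQ ordQ fvQ gQ valQ] := sndQ.
pose T := [seq F <- map fst (crits P) | qrank F == r].
have T_gt0 : 0 < size T.
  by rewrite size_filter -has_count; apply/hasP; exists c0.1; rewrite ?map_f ?c0r.
have [F [h1 [h2 [hE TF nF free]]]] := henkin_split T_gt0 ordQ.
have [/eqP Fr FP] : qrank F == r /\ F \in map fst (crits P).
  by move: TF; rewrite mem_filter => /andP[].
have le_h : {in henkins Q, forall h, qrank h.1 <= qrank F}.
  move=> h; rewrite mem_filter Fr => /andP[/orP[/ltnW//|/mapP[c cP ->] _]].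
  exact: le_r.
have ord12 : henkin_ordered (h1 ++ h2) by rewrite -hE.
have fv12 : {in h1 ++ h2, forall h, ~~ foccurs h.2 (iter k (@Ex S) E)}.
  by rewrite -hE.
have [H [sigma [ordH fvH ren]]] := fresh_copies F (crit_terms Q F) ord12 fv12.
have free_id G t : G \in T -> t \in crit_terms Q F -> qsubst (sigma t) G = G.
  move=> TG /ren[_ _ ren3]; apply: qsubst_id => a occ_a; apply: ren3.
  by apply: contraL occ_a => /mapP[h hh ->]; apply: free.
exists (eliminate Q F sigma (H ++ [seq h <- h1 | h.1 != F] ++ h2)), F => //.
split; last first.
- move=> c'; rewrite /= mem_cat => /orP[|/allpairsP[[t c] /= [tQ + ->]]].
    by rewrite mem_filter => /andP[c'F c'P]; exists c'.
  rewrite mem_filter => /andP[cF cP]; exists c => //.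
  split=> //= [|cr]; first by rewrite qrank_qsubst.
  by apply: free_id; rewrite // mem_filter cr eqxx map_f.
- exact: (size_eliminate (P := Q)).
have qfeqQ : {in eqs Q, forall A, qfree A} by move=> A /eqQ/EQ_qfree.
have le_cQ : {in crits Q, forall c, qrank c.1 <= qrank F} by rewrite Fr.
split=> //.
- move=> A; rewrite /= mem_cat => /orP[/eqQ//|/allpairsP[[t B] /= [_ /eqQ EB ->]]].
  exact: EQ_fsubst.
- move=> h; rewrite /= !mem_cat => /or3P[/fvH//| |h2h].
    by rewrite mem_filter => /andP[_ h1h]; apply: fv12; rewrite mem_cat h1h.
  by apply: fv12; rewrite mem_cat h2h orbT.
- by rewrite /= size_cat ltn_addr.
move=> v /= /allP eqv /allP cv hv.
have [/allP allF|/allPn[t tQ tF]] :=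
    boolP (all (fun t => eval v (inst [:: t] F.2) == F.1) (crit_terms Q F)).
  have [|||v' [eqv' cv' hv' gv']] :=
      eval_eliminate_true qfE qfeqQ le_cQ le_h _ _ _ allF.
  - by apply/allP=> A AQ; apply: eqv; rewrite mem_cat AQ.
  - by move=> c cP cF; apply: cv; rewrite mem_cat mem_filter cF cP.
  - move=> h; rewrite hE mem_cat => hh hF; apply: (allP hv).
    by rewrite !mem_cat mem_filter hF /= hh orbT.
  rewrite has_cat; apply/orP; left.
  by have := valQ v' eqv' cv' hv'; apply: sub_has => ts; rewrite gv'.
have h1F : {in h1, forall h, ~~ foccurs h.2 (qform F)} by move=> h; apply: free.
have [|||v' [eqv' cv' hv' gv']] := eval_eliminate_false
    qfE qfeqQ le_cQ le_h hE ord12 nF h1F (ren _ tQ) _ _ _ tF.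
- move=> A AQ; apply: eqv; rewrite mem_cat; apply/orP; right.
  exact: (allpairs_f (fun t A => fsubst (sigma t) A)).
- move=> c cP cF; apply: cv; rewrite mem_cat; apply/orP; right.
  by apply: (allpairs_f (fun t c => csubst (sigma t) c)); rewrite // mem_filter cF.
- by move: hv; rewrite !all_cat => /and3P[-> _ ->].
have /hasP[ts tsP tsv] := valQ v' eqv' cv' hv'.
rewrite has_cat; apply/orP; right; apply/hasP.
exists (map_tuple (tsubst (sigma t)) ts).
  exact: (allpairs_f (fun t (g : k.-tuple _) => map_tuple (tsubst (sigma t)) g)).
(* Moved constants do not occur in the end formula, so the substitution changes only the inserted
   terms. *)
move: tsv; rewrite gv' fsubst_inst // => a; rewrite size_tuple => occ_a.
have [_ _ ren3] := ren _ tQ; apply: ren3; apply/mapP=> -[h hh eq_a].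
by have := fv12 h; rewrite mem_cat hh -eq_a occ_a => /(_ isT).
Qed.

(** Each step removes a formula from the list [L] of those of rank [r] and at most squares the
    size. *)
Lemma eliminate_rank (S : signature) (k : nat) (E : form S) r o
    (P : problem S k) L :
  qfree E -> sound E P -> {in crits P, forall c, qrank c.1 <= r} ->
  {in crits P, forall c, qrank c.1 = r -> c.1 \in L} -> size L <= o ->
  exists P' : problem S k, [/\ sound E P',
    size (crits P') + size (goals P') <= (size (crits P) + size (goals P)) ^ (2 ^ o)
  & {in crits P', forall c', qrank c'.1 != r /\
      exists2 c, c \in crits P & qrank c'.1 = qrank c.1}].
Proof.
move=> qfE; elim: o P L => [|o IH] P L sndP le_r inL sizeL.
  exists P; split=> // c cP; split; last by exists c.
  by apply/eqP=> /(inL _ cP); move: sizeL; rewrite leqn0 size_eq0 => /eqP->.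
have [has_r|no_r] := boolP (has (fun c => qrank c.1 == r) (crits P)); last first.
  exists P; split=> // [|c cP].
    case: sndP => _ _ _ g_gt0 _.
    by rewrite -{1}[X in X <= _]expn1 leq_pexp2l ?expn_gt0 ?addn_gt0 ?g_gt0 ?orbT.
  by split; [exact: (hasPn no_r) | exists c].
have [P1 [F [FP Fr] [snd1 size1 crits1]]] := eliminate_step qfE sndP le_r has_r.
have [|||P2 [snd2 size2 crits2]] := IH P1 (filter (predC1 F) L) snd1.
- by move=> c' /crits1[c cP [_ -> _]]; apply: le_r.
- move=> c' /crits1[c cP [cF eq_r eq_c] c'r].
  have cr : qrank c.1 = r by rewrite -eq_r.
  by rewrite mem_filter eq_c //= cF inL.
- have FL : F \in L by case/mapP: FP Fr => c cP -> /(inL _ cP).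
  rewrite -ltnS (leq_trans _ sizeL) // size_filter -(count_predC (predC1 F) L).
  by rewrite -addn1 leq_add2l -has_count; apply/hasP; exists F; rewrite //= eqxx.
exists P2; split=> // [|c' /crits2[c'r [c1 /crits1[c cP [_ eq_r _]] eq_r']]].
  apply: leq_trans size2 _; rewrite expnS expnM leq_exp2r ?expn_gt0 //.
by split=> //; exists c; rewrite // eq_r'.
Qed.

(** * Hyperexponential growth and the descent through the ranks *)

Lemma hyperexpD n1 n2 m : hyperexp (n1 + n2) m = hyperexp n1 (hyperexp n2 m).
Proof. by elim: n1 => //= n1 ->. Qed.

Lemma hyperexp_leq n1 n2 m1 m2 :
  n1 <= n2 -> m1 <= m2 -> hyperexp n1 m1 <= hyperexp n2 m2.
Proof.
move=> le_n le_m; apply: (@leq_trans (hyperexp n1 m2)).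
  by elim: n1 {le_n} => //= n IH; rewrite leq_exp2l.
elim: n2 le_n => [|n IH]; first by rewrite leqn0 => /eqP->.
rewrite leq_eqVlt => /predU1P[->//|/IH/leq_trans]; apply.
exact/ltnW/ltn_expl.
Qed.

(** As [z + 1 <= 2 ^ z], the hypothesis gives [z' + 1 <= 2 ^ (z * 2 ^ z)]. The factor 2 adds one to
    the exponent, which stays at most [(z + 1) * 2 ^ z <= 2 ^ (2 * z)]. With doubling on both sides
    the estimate can be iterated. *)
Lemma leq_hyperexp2 z z' : z'.+1 <= z.+1 ^ (2 ^ z) -> 2 * z' <= 2 ^ (2 ^ (2 * z)).
Proof.
move=> le_z'; have lt_z : z < 2 ^ z by apply: ltn_expl.
have le1 : z'.+1 <= 2 ^ (z * 2 ^ z).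
  by rewrite expnM (leq_trans le_z') // leq_exp2r ?expn_gt0.
apply: (@leq_trans (2 ^ (z * 2 ^ z).+1)).
  by rewrite expnS leq_mul2l /= ltnW.
rewrite leq_exp2l // mul2n -addnn expnD.
by rewrite (leq_trans _ (leq_mul lt_z (leqnn _))) // mulSn -add1n leq_add2r expn_gt0.
Qed.

(** An eliminated rank does not return and no new rank appears, so [d] rounds suffice, each costing
    two exponentials by [leq_hyperexp2]. *)
Lemma eliminate_all (S : signature) (k : nat) (E : form S) d (P : problem S k)
    (ranks : seq nat) :
  qfree E -> sound E P -> {in crits P, forall c, qrank c.1 \in ranks} ->
  size ranks <= d ->
  exists P' : problem S k, [/\ sound E P', crits P' = [::] &
    2 * (size (goals P')).-1 <=
      hyperexp (2 * d) (2 * (size (crits P) + size (goals P)).-1)].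
Proof.
move=> qfE; elim: d P ranks => [|d IH] P ranks sndP inR sizeR.
  exists P; move: sizeR; rewrite leqn0 size_eq0 => /eqP R0; rewrite R0 in inR.
  by case: (crits P) inR => [|c cs] // /(_ c); rewrite mem_head => /(_ isT).
have [P0|P_gt0] := posnP (size (crits P)).
  exists P; split=> //; first exact: size0nil.
  by rewrite P0; apply: (@hyperexp_leq 0).
have [r le_r r_in] : exists2 r, {in crits P, forall c, qrank c.1 <= r} &
    exists2 c, c \in crits P & qrank c.1 = r.
  elim: (crits P) P_gt0 => //= c [_ _|c1 cs /(_ isT)[r le_r [c2 c2P c2r]] _].
    exists (qrank c.1); last by exists c; rewrite ?mem_head.
    by move=> c'; rewrite inE => /eqP->.
  have [le_cr|lt_rc] := leqP (qrank c.1) r.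
    exists r; last by exists c2; rewrite // inE c2P orbT.
    by move=> c'; rewrite inE => /predU1P[->|/le_r].
  exists (qrank c.1); last by exists c; rewrite ?mem_head.
  by move=> c'; rewrite inE => /predU1P[->//|/le_r/leq_trans->//]; apply: ltnW.
have inL : {in crits P, forall c, qrank c.1 = r -> c.1 \in map fst (crits P)}.
  by move=> c cP _; apply: map_f.
have g_gt0 : 0 < size (goals P) by case: sndP.
(* Since there is a goal, the number of critical axioms, and so of formulas of rank [r], is at most
   the total minus one. *)
have [|P1 [snd1 size1 crits1]] :=
    eliminate_rank (o := (size (crits P) + size (goals P)).-1) qfE sndP le_r inL.
  by rewrite size_map -(prednK g_gt0) addnS leq_addr.
have [||P2 [snd2 crits2 size2]] := IH P1 (filter (predC1 r) ranks) snd1.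
- move=> c' /crits1[c'r [c cP eq_r]].
  by rewrite mem_filter /= c'r eq_r inR.
- have rR : r \in ranks by case: r_in => c cP <-; apply: inR.
  rewrite -ltnS (leq_trans _ sizeR) // size_filter -(count_predC (predC1 r) ranks).
  by rewrite -addn1 leq_add2l -has_count; apply/hasP; exists r; rewrite //= eqxx.
exists P2; split=> //; apply: leq_trans size2 _.
rewrite mulnS [2 + _]addnC hyperexpD; apply: hyperexp_leq => //.
apply: leq_hyperexp2; rewrite !prednK ?addn_gt0 ?g_gt0 ?orbT //.
by case: snd1 => _ _ _ ->; rewrite orbT.
Qed.

(** * From proofs to problems and back *)

(** A quantifier rule follows from its premise and the Henkin axiom of its eigenvariable:
    [B -> C(a)] and [C(a) -> All C] give [B -> All C], and dually. The facts on occurrences serve to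
    order the Henkin axioms. *)
Lemma step_axioms (S : signature) (G : seq (form S)) A r :
  step_ok G A r ->
  exists es cs hs,
    [/\ {in es, forall B, EQ B}, size cs = critical r, size hs <= 1,
        {in hs, forall h, [/\ eigenvar r = Some h.2, ~~ foccurs h.2 A
           & forall a, foccurs a (qform h.1) -> foccurs a A]}
      & forall v, all (eval v) es -> all (crit_true v) cs ->
          all (henkin_true v) hs ->
          (forall i B, onth G i = Some B -> eval v B) -> eval v A].
Proof.
case: r => /= [tautA|eqA|[B [t ->]]|[B [t ->]]|i j [B [GB GA]]|
  i a [B [C [-> GA nocc]]]|i a [B [C [-> GA nocc]]]].
- by exists [::], [::], [::].
- exists [:: A], [::], [::]; split=> // [B|v]; first by rewrite inE => /eqP->.
  by rewrite /= andbT.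
- exists [::], [:: ((true, B), t)], [::]; split=> // v _.
  by rewrite /= /crit_true /= !eqb_id andbT.
- exists [::], [:: ((false, B), t)], [::]; split=> // v _.
  by rewrite /= /crit_true /= !eqbF_neg andbT implybNN.
- exists [::], [::], [::]; split=> // v _ _ _ Gv.
  exact: (implyP (Gv _ _ GB)) (Gv _ _ GA).
- exists [::], [::], [:: ((true, C), a)]; split=> // [h|v _ _].
    by rewrite inE => /eqP->; split=> // b; rewrite /= orbC => ->.
  rewrite /= /henkin_true /= !eqb_id andbT => /implyP Cv Gv.
  apply/implyP=> Bv; apply: Cv; exact: (implyP (Gv _ _ GA)).
- exists [::], [::], [:: ((false, B), a)]; split=> // [h|v _ _].
    by rewrite inE => /eqP->; split=> // b; rewrite /= => ->.
  rewrite /= /henkin_true /= !eqbF_neg andbT implybNN => /implyP Bv Gv.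
  apply/implyP=> /Bv; exact: (implyP (Gv _ _ GA)).
Qed.

Lemma onth_rcons (T : Type) (s : seq T) x i :
  onth (rcons s x) i =
  if i < size s then onth s i else if i == size s then Some x else None.
Proof.
rewrite -cats1 onth_cat; case: ltngtP => // [lt_i|->]; last by rewrite subnn.
by rewrite onth_default // subn_gt0.
Qed.

Lemma onth_ltn (T : Type) (s : seq T) i x : onth s i = Some x -> i < size s.
Proof. by move=> eq_i; rewrite -onthTE eq_i. Qed.

(** Henkin axioms are listed in the order of their inferences. By regularity an eigenvariable occurs
    in no line from its inference on, hence in no later Henkin formula, whose variables all occur in
    the conclusion of its inference. *)
Lemma proof_axioms (S : signature) (pi : seq (line S)) :
  (forall i B r, onth pi i = Some (B, r) ->
     step_ok (unzip1 (take i pi)) B r) ->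
  regular pi ->
  exists es cs hs,
    [/\ {in es, forall B, EQ B}, size cs = cc pi, henkin_ordered hs,
        {in hs, forall h, exists i B r,
           onth pi i = Some (B, r) /\ eigenvar r = Some h.2}
      & forall v, all (eval v) es -> all (crit_true v) cs ->
          all (henkin_true v) hs ->
          forall i B, onth (unzip1 pi) i = Some B -> eval v B].
Proof.
elim/last_ind: pi => [|pi [A r] IH] ok reg.
  by exists [::], [::], [::]; split=> // v _ _ _ i B; rewrite onth0n.
have onth_pi i x : onth pi i = Some x -> onth (rcons pi (A, r)) i = Some x.
  by move=> eq_i; rewrite onth_rcons (onth_ltn eq_i).
have onth_last : onth (rcons pi (A, r)) (size pi) = Some (A, r).
  by rewrite onth_rcons ltnn eqxx.
have [||es [cs [hs [eqs cs_cc ord eig val]]]] := IH.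
- move=> i B q eq_i; have := ok i B q (onth_pi _ _ eq_i).
  by rewrite -cats1 takel_cat // ltnW ?(onth_ltn eq_i).
- move=> i B q a /onth_pi eq_i /(reg _ _ _ _ eq_i)[reg1 reg2].
  by split=> j C p => [le_ij|] /onth_pi; [apply: reg1 | apply: reg2].
have := ok _ _ _ onth_last; rewrite -cats1 take_size_cat // cats1.
case/step_axioms=> es' [cs' [hs' [eqs' cs'_r hs'1 eig' val']]].
exists (es ++ es'), (cs ++ cs'), (hs ++ hs'); split.
- by move=> B; rewrite mem_cat => /orP[/eqs|/eqs'].
- by rewrite size_cat cs_cc cs'_r /cc -cats1 count_cat /= addn0.
- case/andP: ord => irr pw; apply/andP; split.
    rewrite all_cat irr; apply/allP=> h /eig'[_ nocc occA].
    by apply: contra nocc; apply: occA.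
  rewrite pairwise_cat pw; apply/and3P; split=> //; last first.
    by case: (hs') hs'1 => // h [].
  apply/allrelP=> h h' /eig[i [B [q [eq_i qa]]]] /eig'[ra nocc occA].
  have [reg1 reg2] := reg _ _ _ _ (onth_pi _ _ eq_i) qa.
  have lt_i := onth_ltn eq_i.
  have noccA := reg1 _ _ _ (ltnW lt_i) onth_last.
  apply/andP; split; first by apply: contra noccA; apply: occA.
  apply/eqP=> eq_a; rewrite -eq_a in ra.
  by have eq_s := reg2 _ _ _ onth_last ra; rewrite eq_s ltnn in lt_i.
- move=> h; rewrite mem_cat => /orP[|/eig'[ra _ _]].
    by case/eig=> i [B [q [/onth_pi eq_i qa]]]; exists i, B, q.
  by exists (size pi), A, r.
move=> v; rewrite !all_cat => /andP[ev ev'] /andP[cv cv'] /andP[hv hv'] i B.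
have Gv := val v ev cv hv.
rewrite /unzip1 map_rcons onth_rcons; case: ifP => [_|_]; first exact: Gv.
by case: ifP => // _ [<-]; apply: val'.
Qed.

(** [Phi] stays fixed while [E] varies in the induction, so that the constants avoid the whole end
    formula. Each new constant is fresh, hence its axiom may stand in front. *)
Lemma henkin_iter_Ex (S : signature) (k : nat) (E Phi : form S) hs :
  henkin_ordered hs -> {in hs, forall h, ~~ foccurs h.2 Phi} ->
  exists hs' (ts : k.-tuple (term S)),
    [/\ henkin_ordered hs', {in hs', forall h, ~~ foccurs h.2 Phi}
      & forall v, all (henkin_true v) hs' ->
          all (henkin_true v) hs /\
          (eval v (iter k (@Ex S) E) -> eval v (inst ts E))].
Proof.
move=> ord fv; elim: k E => [|k IH] E.
  exists hs, [tuple]; split=> // v; split=> //=.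
  rewrite /inst fsubst_id_occ // => n _.
  by rewrite nth_nil subn0.
have [hs' [ts [ord' fv' val]]] := IH (Ex E).
pose F := (false, fsubst (up (fun i => nth (Var (i - size ts)) ts i)) E).
(* The index 0 is a dummy that lets the bound cover [F]. *)
have [N ubN] := henkins_bound ((F, 0) :: hs').
have [M ubM] := form_bound Phi.
pose c := maxn N M; have ub := ubN c (leq_maxl _ _).
exists ((F, c) :: hs'), [tuple of Var c :: ts]; split.
- case/andP: ord' => irr pw; rewrite /henkin_ordered /= irr pw !andbT.
  have /ub/andP[-> _] := mem_head (F, 0) hs'.
  apply/allP=> h hh; have /ub/andP[nocc lt_h] : h \in (F, 0) :: hs'.
    by rewrite inE hh orbT.
  by rewrite /henkin_before /= nocc neq_ltn lt_h orbT.
- by move=> h; rewrite inE => /predU1P[->|/fv'//]; rewrite ubM ?leq_maxr.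
move=> v; rewrite [all _ _]/= => /andP[Fv /val[hv Ev]]; split=> //.
rewrite iterSr => /Ev exv.
move: Fv; rewrite /henkin_true inst_cons /= !eqbF_neg.
by rewrite implybNN => /implyP; apply.
Qed.

(** The derivation lists the [m] equality axioms, then at line [m] the tautology with these as
    premises and [D] as conclusion, and detaches one premise per line: line [m + j] is [C j], and
    line [m + m] is [D]. *)
Lemma ECeq_provable_taut (S : signature) (es : seq (form S)) D :
  {in es, forall A, EQ A} -> qfree D ->
  (forall v, all (eval v) es -> eval v D) -> ECeq_provable D.
Proof.
move=> eqs qfD val; pose m := size es.
pose C j := foldr (@Imp S) D (drop j es).
pose L i : line S := if i < m then (nth D es i, ByEQ) else
  (C (i - m), if i == m then ByTaut else ByMP i.-1 (i.-1 - m)).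
have qfC j : qfree (C j).
  rewrite /C; have: {subset drop j es <= es} by move=> A; apply: mem_drop.
  elim: (drop j es) => //= A l IH sub; rewrite IH ?andbT; last first.
    by move=> B lB; apply: sub; rewrite inE lB orbT.
  by apply: EQ_qfree; apply: eqs; apply: sub; rewrite mem_head.
have onthL n i : i < n -> onth (mkseq L n) i = Some (L i).
  move=> lt_i; have : onth (mkseq L n) i by rewrite onthTE size_mkseq.
  case eq_i: (onth _ _) => [x|] // _.
  by rewrite -(onth_nth (L 0) _ _ _ eq_i) nth_mkseq.
have onthL1 n i : i < n -> onth (unzip1 (mkseq L n)) i = Some (L i).1.
  by move=> lt_i; rewrite onth_map onthL.
exists (mkseq L (m + m).+1); split; first split.
- move=> i B r eq_i; have := onth_ltn eq_i; rewrite size_mkseq => lt_i.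
  have -> : take i (mkseq L (m + m).+1) = mkseq L i.
    by rewrite /mkseq -map_take take_iota (minn_idPl (ltnW lt_i)).
  move: eq_i; rewrite onthL // => -[]; rewrite {1}/L; case: ltnP => [lt_im|le_mi].
    by case=> <- <- /=; apply/eqs/mem_nth.
  case: eqP => [->|/eqP neq_i] [<- <-].
    move=> v; rewrite subnn /C drop0.
    move: (val v); elim: (es) => [|A l IH] //= allv; first exact: allv.
    by apply/implyP=> Av; apply: IH => lv; apply: allv; rewrite Av.
  have lt_mi : m < i by rewrite ltn_neqAle eq_sym neq_i.
  have i_gt0 : 0 < i by apply: leq_trans lt_mi.
  have le_mi' : m <= i.-1 by rewrite -ltnS prednK.
  have lt_j : i.-1 - m < m by rewrite -subSn // prednK // leq_subLR -ltnS.
  exists (nth D es (i.-1 - m)); rewrite !onthL1 ?prednK //=.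
    rewrite /L lt_j ltnNge le_mi' /=; split=> //.
    by rewrite /C (drop_nth D lt_j) /= -subSn // prednK.
  by rewrite (leq_trans lt_j) // ltnW.
- exists (mkseq L (m + m)), (L (m + m)).2.
  rewrite /mkseq -[(m + m).+1]addn1 iotaD map_cat cats1 add0n.
  congr rcons; rewrite /L ltnNge leq_addr /= addnK.
  by rewrite /C drop_size.
rewrite /mkseq all_map; apply/allP=> i _; rewrite [preim _ _ _]/= /L.
case: ltnP => [lt_im|_] /=; last by rewrite qfC; case: ifP.
by rewrite andbT; apply/EQ_qfree/eqs/mem_nth.
Qed.

Lemma eval_bigOr (S : signature) v (A : nat -> form S) n :
  eval v (bigOr A n) = has (fun i => eval v (A i)) (iota 0 n.+1).
Proof.
elim: n => [|n IH]; first by rewrite /= orbF.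
by rewrite -[n.+2]addn1 iotaD has_cat -IH /= orbF.
Qed.

Lemma qfree_bigOr (S : signature) (A : nat -> form S) n :
  (forall i, qfree (A i)) -> qfree (bigOr A n).
Proof. by move=> qfA; elim: n => [|n IH] /=; rewrite ?IH qfA. Qed.

Theorem mainTheorem3 (S : signature) (k : nat) (E : form S)
    (pi : seq (line S)) :
  qfree E ->
  PCeq_proof pi (iter k (@Ex S) E) ->
  exists n : nat, n <= hyperexp (2 * cc pi) (3 * cc pi) /\
    exists t : nat -> k.-tuple (term S),
      ECeq_provable (bigOr (fun i => inst (t i) E) n).
Proof.
move=> qfE [[ok [pi' [r eq_pi]]] reg].
have [es [cs [hs [eqs cs_cc ord eig val]]]] := proof_axioms ok reg.
have onth_last : onth pi (size pi') = Some (iter k (@Ex S) E, r).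
  by rewrite eq_pi onth_rcons ltnn eqxx.
have fv : {in hs, forall h, ~~ foccurs h.2 (iter k (@Ex S) E)}.
  move=> h /eig[i [B [q [eq_i qa]]]]; have [reg1 _] := reg _ _ _ _ eq_i qa.
  apply: reg1 onth_last; have := onth_ltn eq_i.
  by rewrite eq_pi size_rcons ltnS.
have [hs' [ts [ord' fv' val']]] := henkin_iter_Ex k E ord fv.
pose P := Problem es cs hs' [:: ts].
have sndP : sound E P.
  split=> //= v ev cv /val'[hv Ev]; rewrite orbF; apply: Ev.
  by apply: (val v ev cv hv (size pi')); rewrite onth_map onth_last.
have [||P' [sndP' crits0 sizeP']] :=
    eliminate_all (d := cc pi) (ranks := [seq qrank c.1 | c <- cs]) qfE sndP.
- by move=> c cP; apply: map_f.
- by rewrite size_map cs_cc.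
(* All ranks are at least 1, so without critical axioms dropping from rank 1 on removes every Henkin
   axiom. *)
have := sound_drop qfE sndP' (ltn0Sn 0); rewrite crits0 => /(_ (fun c => _)).
case=> //= eqs' _ _ g_gt0 valP'.
pose t i := nth ts (goals P') i.
(* Disjuncts are numbered from 0. With [cc pi] critical axioms and one initial goal, the estimate
   starts from [2 * cc pi], below the required [3 * cc pi]. *)
exists (size (goals P')).-1; split.
  apply: (@leq_trans (2 * (size (goals P')).-1)); first exact: leq_pmull.
  apply: leq_trans sizeP' _; apply: hyperexp_leq => //.
  by rewrite /= addn1 cs_cc leq_mul2r orbT.
exists t; apply: ECeq_provable_taut eqs' _ _.
  by apply: qfree_bigOr => i; rewrite qfree_fsubst.
move=> v ev; rewrite eval_bigOr prednK //.
have /(has_nthP ts)[] : has (fun g : k.-tuple _ => eval v (inst g E)) (goals P').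
  apply: valP' => //; apply/allP=> h; rewrite mem_filter orbF.
  by rewrite qrankE.
by move=> i lt_i gv; apply/hasP; exists i; rewrite // mem_iota.
Qed.
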